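(* Let $(A,\cdot,\alpha)$ be a Hom-pre-Malcev algebra. Then the commutator $[x,y]=x\cdot y-y\cdot x$, for all $x,y\in A$, defines a Hom-Malcev algebra structure $(A,[-,-],\alpha)$ on $A$.
   Context: All vector spaces are over a field $\mathbb K$ of characteristic $0$. A Hom-algebra $(A,\mu,\alpha)$ is a vector space $A$ with a bilinear map $\mu:A\times A\to A$ and a linear map $\alpha:A\to A$; all Hom-algebras are assumed multiplicative, i.e. $\alpha(\mu(x,y))=\mu(\alpha(x),\alpha(y))$. A Hom-Malcev algebra is a Hom-algebra $(A,[-,-],\alpha)$ with $[-,-]$ anti-symmetric and, for all $x,y,z\in A$, $J_\alpha(\alpha(x),\alpha(y),[x,z])=[J_\alpha(x,y,z),\alpha^2(x)]$, where $J_\alpha(x,y,z)=[[x,y],\alpha(z)]+[[y,z],\alpha(x)]+[[z,x],\alpha(y)]$. A Hom-pre-Malcev algebra is a Hom-algebra $(A,\cdot,\alpha)$ such that, with $[x,y]=x\cdot y-y\cdot x$, for all $x,y,z,t\in A$: $$[\alpha(y),\alpha(z)]\cdot\alpha(x\cdot t)+[[x,y],\alpha(z)]\cdot\alpha^2(t)+\alpha^2(y)\cdot([x,z]\cdot\alpha(t))-\alpha^2(x)\cdot(\alpha(y)\cdot(z\cdot t))+\alpha^2(z)\cdot(\alpha(x)\cdot(y\cdot t))=0.$$ *)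

(* Defs.v *)
From HB Require Import structures.
From mathcomp Require Import all_boot all_algebra.

Set Implicit Arguments.
Unset Strict Implicit.
Unset Printing Implicit Defensive.

Import GRing.Theory.
Local Open Scope ring_scope.

Record is_hom_algebra (K : fieldType) (A : lmodType K)
    (mu : A -> A -> A) (alpha : A -> A) : Prop := IsHomAlgebra {
  hom_algebra_bilinear : bilinear_for *:%R *:%R mu;
  hom_algebra_linear : linear alpha;
  hom_algebra_multiplicative : {morph alpha : x y / mu x y}
}.

Definition commutator (A : zmodType) (mu : A -> A -> A) (x y : A) : A :=
  mu x y - mu y x.

Definition hom_jacobian (A : zmodType) (br : A -> A -> A) (alpha : A -> A)
    (x y z : A) : A :=
  br (br x y) (alpha z) + br (br y z) (alpha x) + br (br z x) (alpha y).

Record is_hom_malcev (K : fieldType) (A : lmodType K)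
    (br : A -> A -> A) (alpha : A -> A) : Prop := IsHomMalcev {
  hom_malcev_hom_algebra : is_hom_algebra br alpha;
  hom_malcev_antisymmetric : forall x y : A, br x y = - br y x;
  hom_malcev_identity : forall x y z : A,
    hom_jacobian br alpha (alpha x) (alpha y) (br x z) =
    br (hom_jacobian br alpha x y z) (alpha (alpha x))
}.

Record is_hom_pre_malcev (K : fieldType) (A : lmodType K)
    (mu : A -> A -> A) (alpha : A -> A) : Prop := IsHomPreMalcev {
  hom_pre_malcev_hom_algebra : is_hom_algebra mu alpha;
  hom_pre_malcev_identity : forall x y z t : A,
    let br := commutator mu in
    mu (br (alpha y) (alpha z)) (alpha (mu x t))
    + mu (br (br x y) (alpha z)) (alpha (alpha t))
    + mu (alpha (alpha y)) (mu (br x z) (alpha t))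
    - mu (alpha (alpha x)) (mu (alpha y) (mu z t))
    + mu (alpha (alpha z)) (mu (alpha x) (mu y t)) = 0
}.

(* Main.v *)
Require Import Defs.
From HB Require Import structures.
From mathcomp Require Import all_boot all_algebra.
Import GRing.Theory.
Local Open Scope ring_scope.

(** In the free algebra, write [P x y z t] for the left-hand side of the
    Hom-pre-Malcev identity. Once [alpha] has been pushed down to the variables,
    the difference of the two sides of the Hom-Malcev identity of the
    commutator is the integral combination
    [P x x y z - P x y z x + P x z x y - P x z y x - P y z x x - P z x y x],
    found by solving a linear system over the nonassociative monomials of
    multidegree (2, 1, 1). *)

(** Syntax for a reflexive decision of identities in abelian groups: a variable is an index into a
    list of atoms, and integer coefficients serve as normal form. *)
Inductive zmod_expr :=
  | ZVar of nat
  | ZZero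
  | ZAdd of zmod_expr & zmod_expr
  | ZOpp of zmod_expr.

Fixpoint zmod_eval {V : zmodType} (env : seq V) (e : zmod_expr) : V :=
  match e with
  | ZVar n => env`_n
  | ZZero => 0
  | ZAdd e1 e2 => zmod_eval env e1 + zmod_eval env e2
  | ZOpp e1 => - zmod_eval env e1
  end.

Fixpoint zmod_coef (e : zmod_expr) (i : nat) : int :=
  match e with
  | ZVar n => (n == i)%:Z
  | ZZero => 0
  | ZAdd e1 e2 => zmod_coef e1 i + zmod_coef e2 i
  | ZOpp e1 => - zmod_coef e1 i
  end.

Lemma zmod_eval_sum (V : zmodType) (env : seq V) (e : zmod_expr) :
  zmod_eval env e = \sum_(i < size env) env`_i *~ zmod_coef e i.
Proof.
elim: e => [n||e1 IH1 e2 IH2|e1 IH1] /=.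
- have [lt_n|ge_n] := ltnP n (size env).
    rewrite (bigD1 (Ordinal lt_n)) //= eqxx big1 ?addr0 // => i.
    by rewrite -val_eqE eq_sym /= => /negbTE ->.
  (* An index out of range evaluates to the default [0], and no term of the sum sees it. *)
  rewrite nth_default // big1 // => i _.
  by rewrite gtn_eqF // (leq_trans (ltn_ord i)).
- by rewrite big1.
- by rewrite IH1 IH2 -big_split; apply: eq_bigr => i _; rewrite mulrzDr.
- by rewrite IH1 -sumrN; apply: eq_bigr => i _; rewrite mulrNz.
Qed.

(** The premise involves the atoms only through [size env], so it is closed by computation even when
    [V] is abstract. *)
Lemma zmod_eval_eq (V : zmodType) (env : seq V) (e1 e2 : zmod_expr) :
  all (fun i => zmod_coef e1 i == zmod_coef e2 i) (iota 0 (size env)) ->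
  zmod_eval env e1 = zmod_eval env e2.
Proof.
move/allP=> eq_coef; rewrite !zmod_eval_sum; apply: eq_bigr => i _.
by rewrite (eqP (eq_coef i _)) // mem_iota ltn_ord.
Qed.

Ltac zmod_index x env :=
  lazymatch env with
  | x :: _ => constr:(0%N)
  | _ :: ?env' => let n := zmod_index x env' in constr:(n.+1)
  end.

(** [zmod_index] fails on an exhausted list; [match] then backtracks to the branch that adds [x]. *)
Ltac zmod_insert x env :=
  match env with
  | _ => let n := zmod_index x env in env
  | _ => constr:(x :: env)
  end.

Ltac zmod_atoms e env :=
  lazymatch e with
  | 0 => env
  | ?a + ?b => let env' := zmod_atoms a env in zmod_atoms b env'
  | - ?a => zmod_atoms a env
  | ?x => zmod_insert x env
  end.

Ltac zmod_reify e env :=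
  lazymatch e with
  | 0 => constr:(ZZero)
  | ?a + ?b =>
      let a' := zmod_reify a env in
      let b' := zmod_reify b env in constr:(ZAdd a' b')
  | - ?a => let a' := zmod_reify a env in constr:(ZOpp a')
  | ?x => let n := zmod_index x env in constr:(ZVar n)
  end.

Ltac zmodule :=
  lazymatch goal with
  | |- @eq ?V ?a ?b =>
      let env0 := zmod_atoms a (@nil V) in
      let env := zmod_atoms b env0 in
      let a' := zmod_reify a env in
      let b' := zmod_reify b env in
      apply: (@zmod_eval_eq _ env a' b'); vm_compute; reflexivity
  end.

Lemma linear_morphD {R : nzRingType} {U V : lmodType R} {f : U -> V} :
  linear f -> {morph f : u v / u + v}.
Proof. by move=> fL u v; have := fL 1 u v; rewrite !scale1r. Qed.

Lemma linear_morphN {R : nzRingType} {U V : lmodType R} {f : U -> V} :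
  linear f -> {morph f : u / - u}.
Proof.
move=> fL u; have fD := linear_morphD fL.
have f0 : f 0 = 0 by apply: (addIr (f 0)); rewrite -fD !add0r.
by apply: (addIr (f u)); rewrite -fD !addNr.
Qed.

Lemma commutator_hom_algebra (K : fieldType) (A : lmodType K)
    (mu : A -> A -> A) (alpha : A -> A) :
  is_hom_algebra mu alpha -> is_hom_algebra (commutator mu) alpha.
Proof.
case=> -[/= mul mur] al am; split=> //.
- split=> /= [y|x] a u v; rewrite /commutator.
    (* The varying argument is on the left in one product and on the right in the other, so both
       linearities of [mu] are used. *)
    by rewrite (mul y) (mur y) /= scalerBr opprD addrACA.
  by rewrite (mul x) (mur x) /= scalerBr opprD addrACA.
- by move=> x y; rewrite /commutator (linear_morphD al) (linear_morphN al) !am.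
Qed.

Theorem proposition3p1 (K : fieldType) (char0 : [pchar K] =i pred0)
    (A : lmodType K) (mu : A -> A -> A) (alpha : A -> A)
    (hA : is_hom_pre_malcev mu alpha) :
  is_hom_malcev (commutator mu) alpha.
Proof.
case: hA => hA P0; split; first exact: commutator_hom_algebra.
  by move=> x y; rewrite /commutator opprB.
case: hA => -[/= mul mur] al am x y z.
(* The explicit type replaces the partial application [mu^~ w] by a pattern that [rewrite] can
   match. *)
have muDl w u v : mu (u + v) w = mu u w + mu v w := linear_morphD (mul w) u v.
have muNl w u : mu (- u) w = - mu u w := linear_morphN (mul w) u.
have muDr w := linear_morphD (mur w); have muNr w := linear_morphN (mur w).
have aD := linear_morphD al; have aN := linear_morphN al.
pose P a b c d :=
  let br := commutator mu in
  mu (br (alpha b) (alpha c)) (alpha (mu a d))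
  + mu (br (br a b) (alpha c)) (alpha (alpha d))
  + mu (alpha (alpha b)) (mu (br a c) (alpha d))
  - mu (alpha (alpha a)) (mu (alpha b) (mu c d))
  + mu (alpha (alpha c)) (mu (alpha a) (mu b d)).
have PE a b c d : P a b c d = 0 := P0 a b c d.
apply: subr0_eq; transitivity
  (P x x y z - P x y z x + P x z x y - P x z y x - P y z x x - P z x y x);
  last by rewrite !PE !(subr0, addr0).
rewrite /P /hom_jacobian /commutator /= {P PE P0}.
(* Both sides become signed sums of monomials with [alpha] on the variables only, so equal monomials
   are syntactically equal atoms. *)
rewrite !(am, muDl, muDr, muNl, muNr, aD, aN).
by zmodule.
Qed.
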